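(* Let $(V, \|\cdot\|_V)$ be a normed vector space over $\mathbb{K}$ ($\mathbb{K}=\mathbb{R}$ or $\mathbb{K}=\mathbb{C}$), let $S \subseteq V$ be any subset, and let $n, p \in \mathbb{N}$ with $n \geq 1$, $p \geq 1$. Then the polynomial Kolmogorov $(n,p)$-width satisfies $$d_{t(n,p)}(S;V) \;\leq\; d^{\otimes}_{n,p}(S;V) \;\leq\; d_n(S;V).$$
   Context: Here $\mathbb{N}=\{1,2,\dots\}$ and $\mathbb{N}_0=\mathbb{N}\cup\{0\}$. All distances and widths take values in $[0,\infty]$. For $n\in\mathbb{N}$, $k\in\mathbb{N}_0$ put $m(n,k):=\binom{n+k-1}{k}$, and for $p\in\mathbb{N}_0$ put $t(n,p):=\sum_{k=0}^{p} m(n,k)$. For $\check{x}=(\check x_1,\dots,\check x_n)\in\mathbb{K}^n$, the symmetric Kronecker product of order $k\ge 0$, written $\check{x}^{\otimes^{\mathrm s} k}\in\mathbb{K}^{m(n,k)}$, is the vector listing (in some fixed order) all monomials of degree exactly $k$ in $\check x_1,\dots,\check x_n$, each once; for $k=0$ it is $1\in\mathbb{K}$. Polynomial mapping of degree $p\in\mathbb{N}_0$: given vectors $v_{kj}\in V$ ($0\le k\le p$, $1\le j\le m(n,k)$), it is the map $$\Gamma_{n,p}:\mathbb{K}^n\to V,\qquad \check{x}\mapsto \sum_{k=0}^{p}\sum_{j=1}^{m(n,k)} \bigl(\check{x}^{\otimes^{\mathrm s} k}\bigr)_j\, v_{kj}.$$ Its image $\widetilde{\mathcal M}_{n,p}:=\operatorname{img}(\Gamma_{n,p})\subset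 V$ is called a polynomially mapped submanifold. For sets $S,T\subseteq V$, $\operatorname{dist}(S,T):=\sup_{s\in S}\inf_{t\in T}\|s-t\|_V$. Classical Kolmogorov $n$-width: $d_n(S;V):=\inf\{\operatorname{dist}(S,U): U\subseteq V \text{ linear subspace},\ \dim U\le n\}$. Polynomial Kolmogorov $(n,p)$-width: $d^{\otimes}_{n,p}(S;V):=\inf \operatorname{dist}(S,\widetilde{\mathcal M}_{l,p})$, where the infimum is over all $l\in\mathbb{N}$ with $l\le n$ and all polynomially mapped submanifolds $\widetilde{\mathcal M}_{l,p}=\operatorname{img}(\Gamma_{l,p})$ of polynomial mappings $\Gamma_{l,p}:\mathbb{K}^l\to V$ of degree $p$ (all choices of the vectors $v_{kj}$). *)

(* Defs.v *)
From mathcomp Require Import all_boot all_order all_algebra.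
From mathcomp Require Import all_classical all_reals all_analysis.
From mathcomp Require Import complex.

Set Implicit Arguments.
Unset Strict Implicit.
Unset Printing Implicit Defensive.

Import Order.TTheory GRing.Theory Num.Theory.
Import numFieldNormedType.Exports.

Local Open Scope classical_set_scope.
Local Open Scope ring_scope.

Definition nmonom (n k : nat) : nat := 'C((n + k - 1)%N, k).

Definition nmonom_upto (n p : nat) : nat := (\sum_(k < p.+1) nmonom n k)%N.

(* Exponent vectors of the monomials of degree exactly k in n variables; each
   exponent is at most k, so 'I_k.+1 loses nothing. *)
Definition exponents (n k : nat) : {set n.-tuple 'I_k.+1} :=
  [set a : n.-tuple 'I_k.+1 | (\sum_(e <- a) (e : nat))%N == k]%SET.

Lemma card_exponents (n k : nat) : #|exponents n k| = nmonom n k.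
Proof.
rewrite /exponents /nmonom; case: n => [|n]; last first.
  rewrite card_ord_partitions addSn subn1 /= -[in RHS]bin_sub ?leq_addl//.
  by rewrite addnK.
case: k => [|k].
  rewrite bin0 (_ : [set _ | _]%SET = [set [tuple]]%SET) ?cards1//.
  by apply/setP => a; rewrite !inE tuple0 big_nil [RHS]eqxx.
rewrite add0n subn1 bin_small//; apply/eqP; rewrite cards_eq0; apply/eqP/setP.
by move=> a; rewrite !inE tuple0 big_nil.
Qed.

(* The fixed order of the monomials is that of the canonical enumeration of
   [exponents n k]. *)
Definition exponent (n k : nat) (j : 'I_(nmonom n k)) : n.-tuple 'I_k.+1 :=
  enum_val (cast_ord (esym (card_exponents n k)) j).

Definition symkron (K : fieldType) (n k : nat) (x : 'rV[K]_n) :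
    'rV[K]_(nmonom n k) :=
  \row_j \prod_(i < n) x 0 i ^+ tnth (exponent j) i.

Definition polymap (K : fieldType) (V : lmodType K) (n p : nat)
    (v : forall k : 'I_p.+1, 'I_(nmonom n k) -> V) (x : 'rV[K]_n) : V :=
  \sum_(k < p.+1) \sum_(j < nmonom n k) symkron k x 0 j *: v k j.

Definition is_basis (K : fieldType) (V : lmodType K) (U : set V) (d : nat)
    (b : 'I_d -> V) : Prop :=
  (forall c : 'rV[K]_d, \sum_(i < d) c 0 i *: b i = 0 -> c = 0) /\
  U = range (fun c : 'rV[K]_d => \sum_(i < d) c 0 i *: b i).

(* The ambient space may be infinite-dimensional, so subspaces are not
   [{vspace V}]. *)
Definition dim_le (K : fieldType) (V : lmodType K) (U : set V) (n : nat)
    : Prop :=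
  exists d : nat, (d <= n)%N /\ exists b : 'I_d -> V, is_basis U b.

(* The norm is passed as an R-valued function [nrm]: over R[i] the norm of a
   [normedModType] takes its values in R[i]. Suprema are taken in [0, +oo], so
   that the supremum over the empty set is 0 and not -oo. *)
Definition setdist (R : realType) (V : zmodType) (nrm : V -> R)
    (S T : set V) : \bar R :=
  maxe 0%E
    (ereal_sup [set ereal_inf [set (nrm (s - t))%:E | t in T] | s in S]).

Definition kolmogorov_width (R : realType) (K : fieldType) (V : lmodType K)
    (nrm : V -> R) (n : nat) (S : set V) : \bar R :=
  ereal_inf [set setdist nrm S U |
             U in [set U : set V | submod_closed (mem U) /\ dim_le U n]].

Definition polynomial_width (R : realType) (K : fieldType) (V : lmodType K)
    (nrm : V -> R) (n p : nat) (S : set V) : \bar R :=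
  ereal_inf [set e : \bar R |
    exists l : nat, (1 <= l <= n)%N /\
    exists v : forall k : 'I_p.+1, 'I_(nmonom l k) -> V,
      e = setdist nrm S (range (polymap v))].

(* Main.v *)
(** A polynomial mapping takes its values in the span of its coefficient
vectors, a subspace of dimension at most t(l,p) <= t(n,p); and a subspace with
basis [b] of size at most n lies in the image of the polynomial mapping whose
only nonzero coefficients are the [b i], attached to the degree-one monomials
x_i.  Enlarging the approximating set can only decrease the distance. *)
Require Import Defs.
From mathcomp Require Import all_boot all_order all_algebra.
From mathcomp Require Import all_classical all_reals all_analysis.
From mathcomp Require Import complex.

Set Implicit Arguments.
Unset Strict Implicit.
Unset Printing Implicit Defensive.

Import Order.TTheory GRing.Theory Num.Theory.
Import numFieldNormedType.Exports.

Local Open Scope classical_set_scope.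
Local Open Scope ring_scope.

Definition lin_span (K : fieldType) (V : lmodType K) (d : nat) (f : 'I_d -> V) :
    set V :=
  range (fun c : 'rV[K]_d => \sum_(i < d) c 0 i *: f i).

Lemma lin_span_submod_closed (K : fieldType) (V : lmodType K) (d : nat)
  (f : 'I_d -> V) : submod_closed (mem (lin_span f)).
Proof.
split.
  apply/mem_set; exists 0 => //.
  by apply: big1 => i _; rewrite mxE scale0r.
move=> a u w /set_mem[c _ <-] /set_mem[e _ <-]; apply/mem_set.
exists (a *: c + e) => //; rewrite scaler_sumr -big_split.
by apply: eq_bigr => i _; rewrite !mxE scalerDl scalerA.
Qed.

(** A linear relation with a nonzero coefficient at [i0] expresses [f i0] through the other vectors,
    so dropping it does not shrink the span. *)
Lemma lin_span_lift (K : fieldType) (V : lmodType K) (d : nat)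
    (f : 'I_d.+1 -> V) (c : 'rV[K]_d.+1) (i0 : 'I_d.+1) :
    \sum_(i < d.+1) c 0 i *: f i = 0 -> c 0 i0 != 0 ->
  lin_span f = lin_span (fun i => f (lift i0 i)).
Proof.
move=> cf0 ci0; apply/seteqP; split=> [_ [e _ <-]|_ [e _ <-]]; last first.
  exists (\row_i (if unlift i0 i is Some j then e 0 j else 0)) => //.
  rewrite (bigD1_ord i0)//= mxE unlift_none scale0r add0r.
  by apply: eq_bigr => i _; rewrite mxE liftK.
(* Subtracting the multiple [e 0 i0 / c 0 i0] of the relation [c] keeps the vector and cancels its
   coordinate at [i0]. *)
exists (\row_i (e 0 (lift i0 i) - e 0 i0 / c 0 i0 * c 0 (lift i0 i))) => //.
transitivity (\sum_(i < d.+1) (e 0 i - e 0 i0 / c 0 i0 * c 0 i) *: f i).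
  by rewrite (bigD1_ord i0)//= divfK// subrr scale0r add0r;
    apply: eq_bigr => i _; rewrite mxE.
under eq_bigr do rewrite scalerBl -scalerA.
by rewrite sumrB -scaler_sumr cf0 scaler0 subr0.
Qed.

(** Induction on [d]: a free family is itself a basis; otherwise a nontrivial relation allows one
    vector to be discarded. *)
Lemma dim_lin_span (K : fieldType) (V : lmodType K) (d : nat) (f : 'I_d -> V) :
  dim_le (lin_span f) d.
Proof.
elim: d f => [|d IH] f.
  exists 0%N; split=> //; exists f; split=> // c _.
  by apply/rowP; case.
have [free|] := pselect
  (forall c : 'rV[K]_d.+1, \sum_(i < d.+1) c 0 i *: f i = 0 -> c = 0).
  by exists d.+1; split=> //; exists f.
move=> /existsNP[c /not_implyP[cf0 c0]].
have /existsNP[i0 /eqP] : ~ (forall i, c 0 i = 0).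
  by move=> h; apply: c0; apply/rowP => i; rewrite h mxE.
move=> ci0; rewrite (lin_span_lift cf0 ci0).
have [m [md b]] := IH (fun i => f (lift i0 i)).
by exists m; split=> //; apply: leqW.
Qed.

Lemma dim_leW (K : fieldType) (V : lmodType K) (U : set V) (m n : nat) :
  (m <= n)%N -> dim_le U m -> dim_le U n.
Proof. by move=> mn [d [dm b]]; exists d; split=> //; apply: leq_trans mn. Qed.

Lemma nmonom_upto_le (l n p : nat) :
  (l <= n)%N -> (nmonom_upto l p <= nmonom_upto n p)%N.
Proof.
move=> ln; apply: leq_sum => k _; apply: leq_bin2l.
by rewrite leq_sub2r// leq_add2r.
Qed.

Lemma setdist_subset (R : realType) (V : zmodType) (nrm : V -> R)
    (S T T' : set V) :
  T `<=` T' -> (setdist nrm S T' <= setdist nrm S T)%E.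
Proof.
move=> TT'; rewrite /setdist ge_max le_max lexx/= le_max; apply/orP; right.
apply: ge_ereal_sup => _ [s Ss <-]; apply: le_trans; last first.
  by apply: ereal_sup_ubound; exists s.
by apply: ereal_inf_le_tmp => _ [t Tt <-]; exists t => //; apply: TT'.
Qed.

(** Flattens the coefficients into a single finite family, the form that [lin_span] takes. Pairs are
    dependent because the number of monomials varies with the degree. *)
Definition coef_family (V : Type) (n p : nat)
    (v : forall k : 'I_p.+1, 'I_(nmonom n k) -> V) :
    'I_#|{: {k : 'I_p.+1 & 'I_(nmonom n k)}}| -> V :=
  fun i => v (tag (enum_val i)) (tagged (enum_val i)).

Lemma card_coef_family (n p : nat) :
  #|{: {k : 'I_p.+1 & 'I_(nmonom n k)}}| = nmonom_upto n p.
Proof.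
rewrite card_tagged sumnE big_map big_enum.
by apply: eq_bigr => k _; rewrite card_ord.
Qed.

Lemma range_polymap_lin_span (K : fieldType) (V : lmodType K) (n p : nat)
    (v : forall k : 'I_p.+1, 'I_(nmonom n k) -> V) :
  range (polymap v) `<=` lin_span (coef_family v).
Proof.
move=> _ [x _ <-].
(* The coordinates are the values of the monomials at [x], flattened in the same order as the
   coefficients. *)
exists (\row_i coef_family (fun k => symkron k x 0) i) => //.
rewrite /polymap sig_big_dep /= [RHS](reindex _ (onW_bij _ (enum_val_bij _)))/=.
by apply: eq_bigr => i _; rewrite mxE.
Qed.

(** The field and [nrm] stay abstract so that the real and complex cases are both instances. *)
Lemma kolmogorov_le_polynomial_width (R : realType) (K : fieldType)
    (V : lmodType K) (nrm : V -> R) (n p : nat) (S : set V) :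
  (kolmogorov_width nrm (nmonom_upto n p) S <= polynomial_width nrm n p S)%E.
Proof.
apply: le_ereal_inf_tmp => _ [l [/andP[_ ln] [v ->]]].
apply: (@le_trans _ _ (setdist nrm S (lin_span (coef_family v)))); last first.
  by apply: setdist_subset; exact: range_polymap_lin_span.
apply: ereal_inf_lbound; exists (lin_span (coef_family v)) => //; split.
  exact: lin_span_submod_closed.
apply: dim_leW (nmonom_upto_le _ ln) _.
by rewrite -card_coef_family; exact: dim_lin_span.
Qed.

Lemma exponent_inj (n k : nat) : injective (@exponent n k).
Proof. by move=> i j /enum_val_inj/cast_ord_inj. Qed.

Lemma exponent_surj (n k : nat) (a : n.-tuple 'I_k.+1) :
  a \in exponents n k -> exists j, exponent j = a.
Proof.
move=> aP; exists (cast_ord (card_exponents n k) (enum_rank_in aP a)).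
by rewrite /exponent cast_ordK enum_rankK_in.
Qed.

(** The exponent vector of the monomial x_i when [k] is 1. Keeping [k] general avoids casts in
    [linear_coef]; for [k] equal to 0, [inord] falls back to 0. *)
Definition unit_exponent (n k : nat) (i : 'I_n) : n.-tuple 'I_k.+1 :=
  [tuple inord (i == i') | i' < n].

Lemma unit_exponent_exponents (n : nat) (i : 'I_n) :
  unit_exponent 1 i \in exponents n 1.
Proof.
rewrite inE big_tuple (bigD1 i)//= big1 => [|i' /negPf ii'].
  by rewrite tnth_mktuple eqxx inordK.
by rewrite tnth_mktuple eq_sym ii' inordK.
Qed.

(** In degree one the sum picks out the [b i] whose variable x_i is the monomial numbered [j],
    without inverting the enumeration. *)
Definition linear_coef (K : fieldType) (V : lmodType K) (n k : nat)
    (b : 'I_n -> V) (j : 'I_(nmonom n k)) : V :=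
  if k == 1%N then \sum_(i < n | exponent j == unit_exponent k i) b i else 0.

Lemma linear_coef_sum (K : fieldType) (V : lmodType K) (n k : nat)
    (b : 'I_n -> V) (x : 'rV[K]_n) :
  \sum_(j < nmonom n k) symkron k x 0 j *: linear_coef b j =
  if k == 1%N then \sum_(i < n) x 0 i *: b i else 0.
Proof.
rewrite /linear_coef; case: eqP => [->|_]; last first.
  by apply: big1 => j _; rewrite scaler0.
under eq_bigr do rewrite scaler_sumr.
(* After the exchange, each [i] receives a contribution from exactly one index [j0], that of the
   monomial x_i. *)
rewrite (exchange_big_dep xpredT)//=; apply: eq_bigr => i _.
have [j0 ej0] := exponent_surj (unit_exponent_exponents i).
rewrite (big_pred1 j0) => [|j]; last first.
  by rewrite -ej0 (inj_eq (@exponent_inj _ _)).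
rewrite mxE ej0 (bigD1 i)//= big1 => [|i' /negPf ii'].
  by rewrite tnth_mktuple eqxx inordK// expr1 mulr1.
by rewrite tnth_mktuple eq_sym ii' inordK// expr0.
Qed.

Lemma polymap_linear (K : fieldType) (V : lmodType K) (n p : nat)
    (b : 'I_n -> V) (x : 'rV[K]_n) : (0 < p)%N ->
  polymap (fun k : 'I_p.+1 => @linear_coef K V n k b) x =
  \sum_(i < n) x 0 i *: b i.
Proof.
move=> p0; rewrite /polymap; under eq_bigr do rewrite linear_coef_sum.
(* Degree 1 is a valid index since [p] is positive, so [inord 1] really has value 1. *)
rewrite -big_mkcond (big_pred1 (inord 1))// => k.
by rewrite /= -val_eqE /= inordK.
Qed.

(** The family is padded with zero vectors. *)
Lemma lin_span_widen (K : fieldType) (V : lmodType K) (d n : nat) (b : 'I_d -> V) :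
  (d <= n)%N -> exists b' : 'I_n -> V, lin_span b `<=` lin_span b'.
Proof.
move=> /subnKC <-.
exists (fun i => if fintype.split i is inl j then b j else 0) => _ [c _ <-].
exists (row_mx c 0) => //; rewrite big_split_ord /= [X in _ + X]big1 => [|i _].
  rewrite addr0; apply: eq_bigr => i _.
  by rewrite row_mxEl (unsplitK (inl i)).
by rewrite row_mxEr mxE scale0r.
Qed.

Lemma polynomial_le_kolmogorov_width (R : realType) (K : fieldType)
    (V : lmodType K) (nrm : V -> R) (n p : nat) (S : set V) :
  (0 < n)%N -> (0 < p)%N ->
  (polynomial_width nrm n p S <= kolmogorov_width nrm n S)%E.
Proof.
move=> n0 p0; apply: le_ereal_inf_tmp => _ [U [_ [d [dn [b [_ ->]]]]] <-].
have [b' bb'] := lin_span_widen b dn.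
pose v (k : 'I_p.+1) := @linear_coef K V n k b'.
apply: (@le_trans _ _ (setdist nrm S (range (polymap v)))).
  (* The number of variables is [n] rather than [d]: the basis may be empty, whereas at least one
     variable is required. *)
  by apply: ereal_inf_lbound; exists n; rewrite n0 leqnn; split=> //; exists v.
apply: setdist_subset => u /bb'[x _ <-].
by exists x => //; exact: polymap_linear.
Qed.

Theorem theorem1 (R : realType) (n p : nat) (hn : (1 <= n)%N) (hp : (1 <= p)%N) :
  (forall (V : normedModType R) (S : set V),
     let nrm := fun x : V => `|x| in
     (kolmogorov_width nrm (nmonom_upto n p) S <= polynomial_width nrm n p S)%E /\
     (polynomial_width nrm n p S <= kolmogorov_width nrm n S)%E) /\
  (forall (V : normedModType R[i]) (S : set V),
     let nrm := fun x : V => complex.Re `|x| in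
     (kolmogorov_width nrm (nmonom_upto n p) S <= polynomial_width nrm n p S)%E /\
     (polynomial_width nrm n p S <= kolmogorov_width nrm n S)%E).
Proof.
by split=> V S nrm; split; first [exact: kolmogorov_le_polynomial_width
  | exact: polynomial_le_kolmogorov_width].
Qed.
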